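(* Let $G$ be a finite simple graph, $v$ a vertex of $G$, and $n\ge 0$ an integer. Let $P_n(G^v)$ denote the $n$-concatenation of $G$ on $v$ (defined in the context). Then $$I(P_n(G^v);x)=I(G-v;x)^{\lfloor n/2\rfloor}\prod_{s=1}^{\lfloor (n+1)/2\rfloor}\left[I(G-v;x)+4x\,I(G-N[v];x)\cos^2\frac{s\pi}{n+2}\right].$$
   Context: For a finite simple graph $H$, $i_k(H)$ is the number of independent sets (sets of pairwise non-adjacent vertices) of size $k$ in $H$, $\alpha(H)$ is the maximum size of an independent set, and the independence polynomial is $I(H;x)=\sum_{k=0}^{\alpha(H)} i_k(H)x^k$ with $i_0(H)=1$; in particular the null graph (no vertices) has independence polynomial $1$. $N(v)$ is the set of neighbours of $v$ and $N[v]=N(v)\cup\{v\}$; $G-v$ and $G-N[v]$ denote the induced subgraphs obtained by deleting the indicated vertices. $P_n$ is the path with vertices $v_1,\dots,v_n$ (edges $v_iv_{i+1}$). The $n$-concatenation $P_n(G^v)$ is the graph obtained by taking $n$ disjoint copies of $G$ and identifying, for each $i=1,\dots,n$, the vertex $v_i$ of the path $P_n$ with the copy of $v$ in the $i$-th copy of $G$; for $n=0$ it is the null graph. $\lfloor\cdot\rfloor$ is the floor function. *)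

(* Defs.v *)
From HB Require Import structures.
From mathcomp Require Import all_boot all_order all_algebra.

Set Implicit Arguments.
Unset Strict Implicit.
Unset Printing Implicit Defensive.

Import GRing.Theory.
Local Open Scope ring_scope.

Record sgraph := SGraph {
  svertex :> finType;
  sedge : rel svertex;
  sedge_sym : symmetric sedge;
  sedge_irrefl : irreflexive sedge
}.

Section Independence.
Variable H : sgraph.

Definition independent (A : {set H}) : bool :=
  [forall x in A, forall y in A, ~~ sedge x y].

Definition indep_count (k : nat) : nat :=
  #|[set A : {set H} | independent A & #|A| == k]|.

Definition indep_number : nat := \max_(A : {set H} | independent A) #|A|.

Definition indep_poly (R : nzRingType) : {poly R} :=
  \sum_(0 <= k < indep_number.+1) (indep_count k)%:R *: 'X^k.

End Independence.

Section Deletion.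
Variable G : sgraph.

Definition open_nbhd (v : G) : {set G} := [set w | sedge v w].

Definition closed_nbhd (v : G) : {set G} := v |: open_nbhd v.

Section Induced.
Variable S : {set G}.

Definition induced_rel : rel {x : G | x \in S} :=
  fun x y => sedge (val x) (val y).

Lemma induced_sym : symmetric induced_rel.
Proof. by move=> x y; rewrite /induced_rel sedge_sym. Qed.

Lemma induced_irrefl : irreflexive induced_rel.
Proof. by move=> x; rewrite /induced_rel sedge_irrefl. Qed.

Definition induced : sgraph := SGraph induced_sym induced_irrefl.

End Induced.

Definition delete (A : {set G}) : sgraph := induced (~: A).

End Deletion.

Section Path.
Variable n : nat.

Definition path_rel : rel 'I_n :=
  fun i j => (i.+1 == j :> nat) || (j.+1 == i :> nat).

Lemma path_sym : symmetric path_rel.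
Proof. by move=> i j; rewrite /path_rel orbC. Qed.

Lemma path_irrefl : irreflexive path_rel.
Proof. by move=> i; rewrite /path_rel orbb gtn_eqF. Qed.

Definition path_graph : sgraph := SGraph path_sym path_irrefl.

End Path.

(* The vertex (i, x) is the copy of x in the i-th copy of G, and the vertex i
   of H is identified with (i, v). *)
Section Attach.
Variables (H G : sgraph) (v : G).

Definition attach_rel : rel (H * G)%type := fun p q =>
  ((p.1 == q.1) && sedge p.2 q.2) ||
  [&& p.2 == v, q.2 == v & sedge p.1 q.1].

Lemma attach_sym : symmetric attach_rel.
Proof.
move=> p q; rewrite /attach_rel eq_sym (sedge_sym p.2) (sedge_sym p.1).
by rewrite andbCA.
Qed.

Lemma attach_irrefl : irreflexive attach_rel.
Proof. by move=> p; rewrite /attach_rel !sedge_irrefl !andbF. Qed.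

Definition attach : sgraph := SGraph attach_sym attach_irrefl.

End Attach.

Definition concatenation (n : nat) (G : sgraph) (v : G) : sgraph :=
  attach (path_graph n) v.

(* Main.v *)
Require Import Defs.
From HB Require Import structures.
From mathcomp Require Import all_boot all_order all_algebra.
From mathcomp Require Import reals trigo ring lra.

(* Write a = I(G - v) and y = x I(G - N[v]).  Sorting the independent sets of
   P_n(G^v) by the set S of path vertices they contain gives
     I(P_n(G^v)) = sum over S independent in P_n of a^(n - |S|) y^|S|,
   a form that satisfies T_(n+2) = a T_(n+1) + a y T_n.  For a = 1 and
   y = -1 / (4 cos^2 t) it equals
     sin ((n + 2) t) / ((2 cos t)^(n + 1) sin t),
   which exhibits (n + 1) / 2 distinct roots t = s pi / (n + 2); together with
   the value 1 at y = 0 and the degree bound (n + 1) / 2 they determine it.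
   The general case follows by homogeneity, substituting y / a in the field of
   fractions. *)

Set Implicit Arguments.
Unset Strict Implicit.
Unset Printing Implicit Defensive.

Import Order.TTheory GRing.Theory Num.Theory.
Local Open Scope ring_scope.

(** * Independence polynomials as sums over independent sets *)

Lemma independentP (H : sgraph) (A : {set H}) :
  reflect {in A &, forall x y, ~~ sedge x y} (independent A).
Proof.
apply: (iffP forall_inP) => [indA x y xA yA | indA x xA].
  by move/forall_inP: (indA x xA); apply.
by apply/forall_inP => y yA; apply: indA.
Qed.

Lemma indep_poly_sum (R : nzRingType) (H : sgraph) :
  indep_poly H R = \sum_(A : {set H} | independent A) 'X^#|A|.
Proof.
have ltA (A : {set H}) : independent A -> (#|A| < (indep_number H).+1)%N.
  by move=> indA; rewrite ltnS; apply: leq_bigmax_cond.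
(* [inord] never falls back to its default on independent sets, since [ltA] bounds their size. *)
pose p (A : {set H}) : 'I_(indep_number H).+1 := inord #|A|.
rewrite (partition_big p xpredT) //= /indep_poly big_mkord.
apply: eq_bigr => k _; rewrite /indep_count -sum1_card scaler_nat -sumrMnr /=.
rewrite big_mkcond [RHS]big_mkcond; apply: eq_bigr => A _; rewrite inE.
case: (boolP (independent A)) => //= indA.
rewrite -val_eqE /= inordK ?ltA //.
by case: eqP => // ->.
Qed.

(** The value at 1 counts the independent sets, and the empty set is one of them. This permits
    division by I(G - v) in the field of fractions. *)
Lemma indep_poly_neq0 (R : numDomainType) (H : sgraph) : indep_poly H R != 0.
Proof.
apply/eqP => /(congr1 (horner^~ 1)) eq0; suff: 1 <= 0 :> R by rewrite ler10.
rewrite -[X in _ <= X](horner0 1) -eq0 indep_poly_sum horner_sum.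
have ind0 : independent (set0 : {set H}).
  by apply/independentP => x y; rewrite inE.
rewrite (bigD1 set0) //= cards0 expr0 hornerC lerDl.
by apply: sumr_ge0 => A _; rewrite hornerXn expr1n.
Qed.

Lemma indep_poly_delete (R : nzRingType) (G : sgraph) (D : {set G}) :
  indep_poly (delete D) R
  = \sum_(A : {set G} | independent A && (A \subset ~: D)) 'X^#|A|.
Proof.
rewrite indep_poly_sum.
have valK (A : {set G}) : A \subset ~: D ->
    val @: [set x : delete D | val x \in A] = A.
  move=> /subsetP sAD; apply/setP => x; apply/imsetP/idP => [[y]|xA].
    by rewrite inE => yA ->.
  by exists (exist _ x (sAD x xA)); rewrite ?inE.
rewrite [RHS](reindex_onto (fun B : {set delete D} => val @: B)
  (fun A => [set x : delete D | val x \in A])); last first.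
  by move=> A /andP[_]; apply: valK.
apply: eq_big => [B | B _]; last by rewrite card_imset //; apply: val_inj.
have -> : val @: B \subset ~: D.
  by apply/subsetP => _ /imsetP[y _ ->]; apply: valP.
have -> : [set x : delete D | val x \in val @: B] = B.
  by apply/setP => x; rewrite inE mem_imset //; apply: val_inj.
rewrite eqxx !andbT; apply/independentP/independentP => indB.
  by move=> _ _ /imsetP[x xB ->] /imsetP[y yB ->]; apply: (indB x y).
by move=> x y xB yB; apply: indB; apply: imset_f.
Qed.

Section IndependentSetsAtVertex.
Variables (R : nzRingType) (G : sgraph) (v : G).

Lemma indep_poly_delete1 :
  indep_poly (delete [set v]) R
  = \sum_(A : {set G} | independent A && (v \notin A)) 'X^#|A|.
Proof.
rewrite indep_poly_delete; apply: eq_bigl => A.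
by rewrite subsetC sub1set inE.
Qed.

(** Adding [v] is a bijection from the independent sets that avoid N[v] onto those that contain [v];
    the factor 'X accounts for the added vertex. *)
Lemma indep_poly_delete_nbhd :
  'X * indep_poly (delete (closed_nbhd v)) R
  = \sum_(A : {set G} | independent A && (v \in A)) 'X^#|A|.
Proof.
rewrite indep_poly_delete big_distrr /=.
rewrite [RHS](reindex_onto (fun A => v |: A) (fun A => A :\ v)); last first.
  by move=> A /andP[_ vA]; rewrite setD1K.
apply: eq_big => [A | A /andP[_ /subsetP dis]]; last first.
  have vA : v \notin A.
    by apply/negP => /dis; rewrite !inE eqxx.
  by rewrite cardsU1 vA exprS.
rewrite setU11 andbT; apply/andP/andP=> -[].
  move=> /independentP indA /subsetP dis.
  have vA : v \notin A by apply/negP => /dis; rewrite !inE eqxx.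
  have nA x : x \in A -> ~~ sedge v x.
    by move=> /dis; rewrite !inE => /norP[].
  split; last by rewrite setU1K.
  apply/independentP => x y; rewrite !inE.
  move=> /predU1P[->|xA] /predU1P[->|yA]; rewrite ?sedge_irrefl ?nA //.
    by rewrite sedge_sym nA.
  exact: indA.
move=> /independentP indA /eqP eqA.
have vA : v \notin A by rewrite -eqA !inE eqxx.
split.
  by apply/independentP => x y xA yA; apply: indA; rewrite !inE ?xA ?yA orbT.
apply/subsetP => x xA; rewrite !inE; apply/norP; split.
  by apply: contraNneq vA => <-.
by apply: indA; rewrite !inE ?eqxx // xA orbT.
Qed.

End IndependentSetsAtVertex.

(** * Independent sets of an attached graph *)

Lemma card_section (I T : finType) (f : {ffun I -> {set T}}) :
  #|[set p : I * T | p.2 \in f p.1]| = (\sum_i #|f i|)%N.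
Proof.
rewrite -sum1_card; under [RHS]eq_bigr do rewrite -sum1_card.
by rewrite pair_big_dep /=; apply: eq_bigl => p; rewrite inE.
Qed.

(** An edge of the attached graph either stays inside one copy of [G] or joins two copies of [v];
    the two conjuncts exclude these two kinds. *)
Lemma independent_attach (H G : sgraph) (v : G) (f : {ffun H -> {set G}}) :
  independent ([set p | p.2 \in f p.1] : {set attach H v})
  = [forall i, independent (f i)] && independent [set i | v \in f i].
Proof.
apply/independentP/andP => [ind | [/forallP indf /independentP indv]].
  split.
    apply/forallP => i; apply/independentP => x y xf yf.
    have := ind (i, x) (i, y); rewrite !inE /= => /(_ xf yf).
    by apply: contra => exy; rewrite /sedge /= /attach_rel /= eqxx exy.
  apply/independentP => i j; rewrite !inE => vi vj.
  have := ind (i, v) (j, v); rewrite !inE /= => /(_ vi vj).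
  by apply: contra => eij; rewrite /sedge /= /attach_rel /= eqxx eij orbT.
move=> [i x] [j y]; rewrite !inE /= => xf yf.
apply/negP; rewrite /sedge /= /attach_rel /= => /orP[/andP[/eqP ij exy]|].
  move: yf; rewrite -ij => yf.
  by move/independentP: (indf i) => /(_ x y xf yf); rewrite exy.
move=> /and3P[/eqP xv /eqP yv eij]; move: xf yf; rewrite xv yv => vi vj.
by have := indv i j; rewrite !inE eij => /(_ vi vj).
Qed.

(* The slices [f i] of an independent set of [attach H v] are chosen
   independently of each other once the set [S] of the [i] with [v \in f i] is
   fixed. *)
Lemma indep_poly_attach (R : comNzRingType) (H G : sgraph) (v : G) :
  indep_poly (attach H v) R
  = \sum_(S : {set H} | independent S) \prod_i
      (if i \in S then 'X * indep_poly (delete (closed_nbhd v)) R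
       else indep_poly (delete [set v]) R).
Proof.
pose sect (f : {ffun H -> {set G}}) : {set attach H v} :=
  [set p | p.2 \in f p.1].
pose slices (A : {set attach H v}) : {ffun H -> {set G}} :=
  [ffun i => [set x | (i, x) \in A]].
rewrite indep_poly_sum (reindex sect); last first.
  exists slices => [f _ | A _].
    by apply/ffunP => i; rewrite ffunE; apply/setP => x; rewrite !inE.
  by apply/setP => -[i x]; rewrite !inE ffunE inE.
rewrite (partition_big (fun f : {ffun H -> {set G}} => [set i | v \in f i])
  (@independent H)) /=; last first.
  by move=> f; rewrite independent_attach => /andP[].
apply: eq_bigr => S indS.
pose Q (i : H) (B : {set G}) := independent B && ((v \in B) == (i \in S)).
(* Expanding this product picks one [B] for each [i], that is, a family [f] whose trace on [v] is
   exactly [S]. *)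
transitivity (\prod_(i : H) \sum_(B : {set G} | Q i B) 'X^#|B| : {poly R}).
  rewrite bigA_distr_big_dep; apply: eq_big => [f | f _].
    rewrite independent_attach -andbA.
    apply/and3P/familyP => [[indf _ /eqP SE] i | Qf].
      by rewrite -topredE /= /Q (forallP indf) -SE inE eqxx.
    have SE : [set i | v \in f i] = S.
      by apply/setP => i; have /andP[_ /eqP] := Qf i; rewrite inE.
    split; rewrite ?SE //; apply/forallP => i.
    by have /andP[] := Qf i.
  by rewrite /sect card_section expr_sum.
apply: eq_bigr => i _; rewrite /Q; case: ifP => _.
  by rewrite indep_poly_delete_nbhd; apply: eq_bigl => B; rewrite eqb_id.
by rewrite indep_poly_delete1; apply: eq_bigl => B; rewrite eqbF_neg.
Qed.

(** * The transfer recursion along the path *)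

(* [b] records whether the vertex before the path has been chosen. *)
Fixpoint transfer (A : pzRingType) (a y : A) (n : nat) (b : bool) : A :=
  if n is m.+1 then
    a * transfer a y m false + (if b then 0 else y * transfer a y m true)
  else 1.

Lemma rmorph_transfer (A B : pzRingType) (f : {rmorphism A -> B}) a y n b :
  f (transfer a y n b) = transfer (f a) (f y) n b.
Proof.
elim: n b => [|n IHn] b /=; first exact: rmorph1.
by rewrite rmorphD rmorphM IHn; case: b; rewrite ?rmorph0 ?rmorphM ?IHn.
Qed.

(** Each of the [n] vertices contributes either [a] or [a * z], so one [a] comes out for every
    vertex. *)
Lemma transfer_scale (A : comPzRingType) (a z : A) n b :
  transfer a (a * z) n b = a ^+ n * transfer 1 z n b.
Proof.
elim: n b => [|n IHn] b /=; first by rewrite mulr1.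
rewrite !IHn exprS; case: b => /=; ring.
Qed.

Definition no_consecutive : rel bool := fun b c => ~~ (b && c).

(** Unrolling the recursion records the choice made at each vertex as one bit of a word. *)
Lemma transfer_tuple (A : comPzRingType) (a y : A) n b :
  transfer a y n b
  = \sum_(t : n.-tuple bool | path no_consecutive b t)
      \prod_(c <- t) (if c then y else a).
Proof.
elim: n b => [|n IHn] b /=.
  rewrite (big_pred1 [tuple]) ?big_nil // => t.
  by rewrite tuple0 /= eqxx.
pose consp (p : bool * n.-tuple bool) := [tuple of p.1 :: p.2].
rewrite (reindex consp) /=; last first.
  exists (fun t => (thead t, [tuple of behead t])) => [[c t] _ | t _] /=.
    by rewrite theadE; congr (_, _); apply: val_inj.
  exact/esym/tuple_eta.
rewrite -(pair_big_dep xpredT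
  (fun c (t : n.-tuple bool) =>
     no_consecutive b c && path no_consecutive c t)
  (fun c (t : n.-tuple bool) => \prod_(d <- c :: t) (if d then y else a))) /=.
rewrite big_bool [RHS]addrC !IHn /no_consecutive andbF andbT /=.
rewrite big_distrr /=; congr (_ + _).
  by apply: eq_bigr => t _; rewrite big_cons.
case: b => /=; first by rewrite big_pred0_eq.
by rewrite big_distrr; apply: eq_bigr => t _; rewrite big_cons.
Qed.

Lemma transfer_path_graph (A : comPzRingType) (a y : A) n :
  \sum_(S : {set path_graph n} | independent S)
    \prod_i (if i \in S then y else a)
  = transfer a y n false.
Proof.
rewrite transfer_tuple.
pose supp (t : n.-tuple bool) : {set path_graph n} := [set i | tnth t i].
rewrite (reindex supp) /=; last first.
  exists (fun S : {set path_graph n} => [tuple (i \in S) | i < n]) => [t _|S _].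
    by apply: eq_from_tnth => i; rewrite tnth_mktuple inE.
  by apply/setP => i; rewrite inE tnth_mktuple.
apply: eq_big => [t | t _]; last first.
  by rewrite big_tuple; apply: eq_bigr => i _; rewrite inE.
(* Starting from [false] puts no constraint on the first bit. *)
have -> : path no_consecutive false t = sorted no_consecutive t.
  by case: t => -[|c s].
apply/forall_inP/(sortedP false) => [ind i | srt i].
  rewrite size_tuple => ltSi; have lti := ltnW ltSi.
  rewrite -(tnth_nth _ t (Ordinal lti)) -(tnth_nth _ t (Ordinal ltSi)).
  apply/negP => /andP[ti tSi].
  have /forall_inP/(_ (Ordinal ltSi)) := ind (Ordinal lti) ltac:(by rewrite inE).
  by rewrite inE => /(_ tSi); rewrite /sedge /= /path_rel /= eqxx.
have nc (j k : 'I_n) : j.+1 = k -> ~~ (tnth t j && tnth t k).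
  move=> jk; rewrite !(tnth_nth false) -jk; apply: srt.
  by rewrite size_tuple jk.
rewrite inE => ti; apply/forall_inP => j; rewrite inE => tj.
apply/negP; rewrite /sedge /= /path_rel => /orP[] /eqP /nc.
  by rewrite ti tj.
by rewrite ti tj.
Qed.

(** * Roots and factorization of the transfer polynomial *)

Section Factorization.
Variable R : realType.

(** The degree is bounded by the number of vertices that can be chosen: at most every other one, the
    first being excluded when [b] holds. *)
Lemma size_transfer_poly n b :
  (size (transfer 1 'X n b : {poly R}) <= (n + ~~ b)./2.+1)%N.
Proof.
elim: n b => [|n IHn] b; first by rewrite /= size_poly1.
rewrite /= mul1r; case: b.
  by rewrite addr0 (leq_trans (IHn _)) //= addn0 addn1.
apply: leq_trans (size_polyD _ _) _; rewrite geq_max; apply/andP; split.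
  by apply: leq_trans (IHn _) _; rewrite ltnS uphalf_half leq_addl.
apply: leq_trans (size_polyMleq _ _) _; rewrite size_polyX.
by apply: leq_trans (IHn true) _; rewrite addn0 addn1.
Qed.

Lemma transfer_horner0 n b : (transfer 1 'X n b : {poly R}).[0] = 1.
Proof.
elim: n b => [|n IHn] b /=; first by rewrite hornerC.
rewrite hornerD mul1r IHn.
by case: b; rewrite ?hornerM ?hornerX ?horner0 ?mul0r addr0.
Qed.

(* [transfer 1 'X] is a rescaled Chebyshev polynomial of the second kind. *)
Lemma transfer_sin (t : R) n b : cos t != 0 ->
  (transfer 1 'X n b).[- (4 * cos t ^+ 2)^-1] * (2 * cos t) ^+ (n + ~~ b) * sin t
  = sin ((n + ~~ b).+1%:R * t).
Proof.
move=> c0.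
have sinSS m : sin (m.+2%:R * t) = 2 * cos t * sin (m.+1%:R * t) - sin (m%:R * t).
  have -> : m.+2%:R * t = m.+1%:R * t + t by rewrite mulrSr mulrDl mul1r.
  have -> : m%:R * t = m.+1%:R * t - t by rewrite [m.+1%:R]mulrSr; ring.
  rewrite sinD sinB; ring.
elim: n b => [|n IHn] b.
  rewrite /= hornerC mul1r; case: b => /=; first by rewrite expr0 !mul1r.
  by rewrite expr1 (_ : 2 * t = t + t) ?sinD; ring.
(* When the first vertex is excluded, what remains is an unconstrained path with one vertex
   fewer. *)
case: b; rewrite /= mul1r.
  by rewrite addr0 addn0 -[n.+1]addn1; apply: (IHn false).
(* The evaluation point times [(2 * cos t) ^+ 2] is -1, which turns the recursion into [sinSS]. *)
rewrite hornerD hornerM hornerX addn1 sinSS.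
have := IHn false; have := IHn true; rewrite /= addn0 addn1 => <- <-.
by rewrite !exprS; field.
Qed.

Lemma size_prod_affine (I : Type) (r : seq I) (c : I -> R) :
  (size (\prod_(i <- r) (1 + c i *: 'X))%R <= (size r).+1)%N.
Proof.
elim: r => [|i r IHr]; first by rewrite big_nil size_poly1.
have s2 : (size (1 + c i *: 'X)%R <= 2)%N.
  rewrite (leq_trans (size_polyD _ _)) // geq_max size_poly1 /=.
  by rewrite (leq_trans (size_scale_leq _ _)) ?size_polyX.
rewrite big_cons (leq_trans (size_polyMleq _ _)) // -subn1 leq_subLR.
exact: leq_add s2 IHr.
Qed.

Lemma transfer_factor n :
  transfer 1 'X n false =
  \prod_(1 <= s < (n.+1 %/ 2).+1)
    (1 + (4 * cos (s%:R * pi / n.+2%:R) ^+ 2) *: 'X) :> {poly R}.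
Proof.
set m := (n.+1 %/ 2)%N.
pose th s : R := s%:R * pi / n.+2%:R.
have n2 : 0 < n.+2%:R :> R by rewrite ltr0n.
have pi0 := pi_gt0 R.
have th_lt s s' : (s < s')%N -> th s < th s'.
  by move=> lts; rewrite /th ltr_pM2r ?invr_gt0 // ltr_pM2r // ltr_nat.
(* From s <= (n + 1) / 2 follows 2s < n + 2, so the angles stay strictly below pi / 2 and their
   cosines are positive. *)
have th_pos s : s \in iota 1 m -> 0 < th s < pi / 2.
  rewrite mem_iota => /andP[s1 sm].
  have -> : 0 = th 0%N by rewrite /th !mul0r.
  rewrite th_lt //= /th ltr_pdivrMr //.
  have : s%:R * 2 < n.+2%:R :> R.
    by rewrite -natrM ltr_nat ltnS -leq_divRL // -ltnS -add1n.
  by rewrite -(ltr_pM2l pi0); lra.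
have th_cos s : s \in iota 1 m -> 0 < cos (th s).
  move=> /th_pos /andP[t0 tpi]; apply: cos_gt0_pihalf; rewrite tpi andbT.
  by apply: lt_trans t0; rewrite oppr_lt0 divr_gt0.
pose rt s : R := - (4 * cos (th s) ^+ 2)^-1.
have c4 s : s \in iota 1 m -> 0 < 4 * cos (th s) ^+ 2.
  by move=> /th_cos c0; rewrite mulr_gt0 // exprn_gt0.
apply/eqP; rewrite -subr_eq0; apply/eqP.
(* The difference has degree at most [m], so 0 together with the [m] points [rt s] is one root too
   many. *)
apply: (@roots_geq_poly_eq0 _ _ (0 :: map rt (iota 1 m))).
- rewrite /= rootE hornerD hornerN transfer_horner0 horner_prod.
  rewrite big1 ?subrr /=; last first.
    by move=> s _; rewrite hornerD hornerC hornerZ hornerX mulr0 addr0.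
  rewrite eqxx all_map; apply/allP => s sI /=.
  rewrite rootE hornerD hornerN.
  have -> : (\prod_(1 <= s < m.+1) (1 + (4 * cos (th s) ^+ 2) *: 'X)).[rt s] = 0.
    apply/eqP; rewrite horner_prod prodf_seq_eq0; apply/hasP; exists s.
      by rewrite /index_iota subSS subn0.
    rewrite hornerD hornerC hornerZ hornerX /rt mulrN.
    by rewrite divff ?(lt0r_neq0 (c4 _ sI)) // subrr eqxx.
  rewrite subr0.
  (* Here (n + 2) [th s] is a multiple of pi, so the sine on the right vanishes while the cosine and
     sine factors on the left do not. *)
  have := @transfer_sin (th s) n false (lt0r_neq0 (th_cos _ sI)).
  have -> : (n + ~~ false).+1%:R * th s = s%:R * pi.
    by rewrite addn1 /th mulrC divfK // gt_eqF.
  have -> k : sin (k%:R * pi : R) = 0.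
    elim: k => [|k IHk]; first by rewrite mul0r sin0.
    by rewrite mulrSr mulrDl mul1r sinDpi IHk oppr0.
  move/eqP; rewrite !mulf_eq0 => /orP[/orP[//|]|].
    by rewrite expf_eq0 mulf_eq0 pnatr_eq0 /= gt_eqF ?andbF // th_cos.
  have /andP[t0 tpi] := th_pos s sI.
  by rewrite gt_eqF // sin_gt0_pihalf // t0.
(* Distinctness: positive cosines are determined by their squares, [cos] is injective on [0, pi],
   and [th] is strictly increasing. The points [rt s] are nonzero, hence differ from 0. *)
- rewrite /= map_inj_in_uniq ?iota_uniq ?andbT; last first.
    move=> s s' sI s'I /oppr_inj/invr_inj/(mulfI (lt0r_neq0 (ltr0n R 4))).
    have nn u : u \in iota 1 m -> cos (th u) \is Num.nneg.
      by move=> /th_cos/ltW.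
    move/eqP; rewrite eqrXn2 ?ltW ?th_cos // => /eqP.
    have thI u : u \in iota 1 m -> th u \in `[0, pi].
      move=> /th_pos/andP[t0 tpi]; rewrite in_itv /= (ltW t0) /=.
      by lra.
    move/(cos_inj (thI _ sI) (thI _ s'I)) => eqt.
    by case: (ltngtP s s') => // /th_lt; rewrite eqt ltxx.
  apply/negP => /mapP[s sI /eqP].
  by rewrite eq_sym oppr_eq0 invr_eq0 gt_eqF // c4.
rewrite /= size_map size_iota.
apply: leq_trans (size_polyD _ _) _; rewrite size_polyN geq_max.
rewrite (leq_trans (size_transfer_poly _ _)) /=; last by rewrite addn1 /m divn2.
by rewrite (leq_trans (size_prod_affine _ _)) // size_iota subn1.
Qed.

Lemma transfer_prod (a y : {poly R}) n : a != 0 ->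
  transfer a y n false =
  a ^+ (n %/ 2) * \prod_(1 <= s < (n.+1 %/ 2).+1)
    (a + (4 * cos (s%:R * pi / n.+2%:R) ^+ 2) *: y).
Proof.
move=> a0; pose K := {fraction {poly R}}.
pose F : {rmorphism {poly R} -> K} := @tofrac {poly R}.
have Fa0 : F a != 0 by rewrite tofrac_eq0.
apply/eqP; rewrite -tofrac_eq -/(F _) -/(F _); apply/eqP.
pose z := F y / F a.
have Fy : F y = F a * z by rewrite mulrC divfK.
rewrite rmorph_transfer Fy transfer_scale.
(* Evaluation at [z], with coefficients embedded as constants of [K], carries the identity in 'X
   over to [z]. *)
pose h := @horner_morph R K (F \o polyC) z (fun x => mulrC _ _).
pose H : {rmorphism {poly R} -> K} := h.
have HX : H 'X = z by apply: horner_morphX.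
rewrite -HX -(rmorph1 H) -rmorph_transfer transfer_factor rmorph_prod /=.
rewrite rmorphM rmorphXn rmorph_prod /=.
have termE (c : R) : F (a + c *: y) = F a * H (1 + c *: 'X).
  rewrite -!mul_polyC !rmorphD !rmorphM rmorph1 HX Fy mulrDr mulr1 mulrCA.
  by congr (_ + _ * (_ * _)); apply/esym/horner_morphC.
under [in RHS]eq_bigr do rewrite termE.
rewrite big_split /= prodr_const_nat subn1 /= mulrA -exprD; congr (F a ^+ _ * _).
(* The powers of [F a] match because floor(n/2) + floor((n+1)/2) = n. *)
by rewrite !divn2 /= uphalf_half addnCA addnn odd_double_half.
Qed.

End Factorization.

Theorem theorem3p1 (R : realType) (G : sgraph) (v : G) (n : nat) :
  indep_poly (concatenation n v) R =
  indep_poly (delete [set v]) R ^+ (n %/ 2)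
  * \prod_(1 <= s < (n.+1 %/ 2).+1)
      (indep_poly (delete [set v]) R
       + 4 *: ('X * indep_poly (delete (closed_nbhd v)) R)
         * (cos (s%:R * pi / n.+2%:R) ^+ 2)%:P).
Proof.
rewrite /concatenation indep_poly_attach transfer_path_graph.
rewrite transfer_prod ?indep_poly_neq0 //; congr (_ * _).
apply: eq_bigr => s _; congr (_ + _).
by rewrite [RHS]mulrC mul_polyC scalerA mulrC.
Qed.
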